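(* Let $\varphi\in C(\mathbb{R})$ satisfy: (i) $\sum_{k\in\mathbb{Z}}\varphi(u-k)=1$ for every $u\in\mathbb{R}$; (ii) $M_2(\varphi)<+\infty$ and $\lim_{r\to\infty}\sum_{|u-k|>r}|\varphi(u-k)|(k-u)^2=0$ uniformly with respect to $u\in\mathbb{R}$; (iii) $\sum_{k\in\mathbb{Z}}\varphi(u-k)(k-u)=0$ for every $u\in\mathbb{R}$. Let $\{a_k\}_{k\in\mathbb{Z}}$ and $\{b_k\}_{k\in\mathbb{Z}}$ be two sequences of real numbers for which there exist constants $\alpha\in\mathbb{R}$, $\Delta^{*}>0$ and $M^{*}<\infty$ such that $a_k+b_k=\alpha$ and $b_k-a_k\ge\Delta^{*}$ for all $k\in\mathbb{Z}$, and $\sup_{k}\{|a_k|,|b_k|\}\le M^{*}$. Let $f\in C^{1}$. Then for every $x\in\mathbb{R}$ and every $w>0$, $$\left|w\big[(K_w^{\varphi}f)(x)-f(x)\big]-\frac{\alpha f'(x)}{2}\right|\le\frac{A}{\Delta^{*}}\,\overline{\omega}\left(f',\frac{\Delta^{*}}{2w}\right),$$ where $A=(M^{*})^2M_0(\varphi)+2M^{*}M_1(\varphi)+M_2(\varphi)$.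
   Context: $C(\mathbb{R})$ denotes the set of all uniformly continuous and bounded functions $\mathbb{R}\to\mathbb{R}$. $C^{1}$ denotes the set of all $f\in C(\mathbb{R})$ such that $f$ is continuously differentiable and $\|f'\|_{\infty}<\infty$. For $\nu\ge 0$ the absolute moment of $\varphi$ is $M_\nu(\varphi):=\sup_{u\in\mathbb{R}}\sum_{k\in\mathbb{Z}}|\varphi(u-k)|\,|k-u|^{\nu}$ (finiteness of $M_2(\varphi)$ implies finiteness of $M_0(\varphi)$ and $M_1(\varphi)$). For a function $g:\mathbb{R}\to\mathbb{R}$ the modulus of continuity is $\omega(g,\delta):=\sup_{|x-y|\le\delta}|g(x)-g(y)|$, and $\overline{\omega}(g,\cdot)$ denotes the least concave majorant of the function $\delta\mapsto\omega(g,\delta)$ on $[0,\infty)$. For $w>0$ and sequences $\{a_k\}_{k\in\mathbb{Z}},\{b_k\}_{k\in\mathbb{Z}}$ with $\Delta_k:=b_k-a_k>0$, the generalized Kantorovich sampling series of $f\in C(\mathbb{R})$ is $$(K_w^{\varphi}f)(x)=\sum_{k=-\infty}^{\infty}\frac{w}{\Delta_k}\,\varphi(wx-k)\int_{\frac{k+a_k}{w}}^{\frac{k+b_k}{w}}f(u)\,du,\qquad x\in\mathbb{R}.$$ *)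

(* Defs.v *)
From HB Require Import structures.
From mathcomp Require Import all_boot all_order all_algebra.
From mathcomp Require Import all_classical all_reals all_analysis.

Set Implicit Arguments.
Unset Strict Implicit.
Unset Printing Implicit Defensive.

Import Order.TTheory GRing.Theory Num.Theory.
Import numFieldNormedType.Exports.

Local Open Scope classical_set_scope.
Local Open Scope ring_scope.

(* Negz n is -(n+1), so this is the sum of c k over -q <= k < p. *)
Definition bilateral_psum (R : realType) (c : int -> R) (pq : nat * nat) : R :=
  \sum_(0 <= i < pq.1) c (Posz i) + \sum_(0 <= i < pq.2) c (Negz i).

(* Both ends of the summation range tend to infinity independently. *)
Definition has_zsum (R : realType) (c : int -> R) (s : R) : Prop :=
  bilateral_psum c pq @[pq --> (\oo, \oo)] --> s.

Definition zsum (R : realType) (c : int -> R) : R :=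
  lim (bilateral_psum c pq @[pq --> (\oo, \oo)]).

Definition CR (R : realType) (f : R -> R) : Prop :=
  unif_continuous f /\ bounded_fun f.

Definition C1 (R : realType) (f : R -> R) : Prop :=
  [/\ CR f, forall x, derivable f x 1,
      continuous (derive1 f) & bounded_fun (derive1 f)].

(* powR satisfies 0 `^ 0 = 1 and 0 `^ nu = 0 for nu != 0. *)
Definition absolute_moment (R : realType) (phi : R -> R) (nu : R) : \bar R :=
  ereal_sup (range (fun u : R =>
    \esum_(k in [set: int])
      (`|phi (u - k%:~R)| * `|k%:~R - u| `^ nu)%:E)).

Definition modulus_of_continuity (R : realType) (g : R -> R) (delta : R)
    : \bar R :=
  ereal_sup [set (`|g p.1 - g p.2|)%:E | p in
             [set p : R * R | `|p.1 - p.2| <= delta]].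

Definition concave_on_nonneg (R : realType) (h : R -> R) : Prop :=
  convex_function (E := R^o) `[0, +oo[ (fun t => - h t).

Definition concave_majorant (R : realType) (g : R -> \bar R) (h : R -> R)
    : Prop :=
  concave_on_nonneg h /\ forall t, 0 <= t -> (g t <= (h t)%:E)%E.

(* The pointwise infimum of the concave majorants on [0, +oo[; see
   least_concave_majorantP. *)
Definition least_concave_majorant (R : realType) (g : R -> \bar R) (t : R)
    : R :=
  inf [set h t | h in [set h : R -> R | concave_majorant g h]].

Definition kantorovich (R : realType) (phi : R -> R) (a b : int -> R) (w : R)
    (f : R -> R) (x : R) : R :=
  zsum (fun k : int =>
    w / (b k - a k) * phi (w * x - k%:~R) *
    \int[lebesgue_measure]_(u in `[(k%:~R + a k) / w, (k%:~R + b k) / w]) f u).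

Lemma concave_on_nonnegP (R : realType) (h : R -> R) :
  concave_on_nonneg h <->
  forall l s t : R, 0 <= l <= 1 -> 0 <= s -> 0 <= t ->
    l * h s + (1 - l) * h t <= h (l * s + (1 - l) * t).
Proof.
have memE (s : R) : (s \in (`[0, +oo[%classic : set R)) = (0 <= s).
  by rewrite mem_setE in_itv /= andbT.
split=> [ch l s t /andP[l0 l1] s0 t0|ch l s t].
  have := ch (Itv01 l0 l1) s t; rewrite !memE => /(_ s0 t0).
  rewrite -[X in (X <= _)]/(- h (l * s + (1 - l) * t)).
  rewrite -[X in (_ <= X)]/(l * - h s + (1 - l) * - h t).
  by rewrite !mulrN -opprD lerN2.
rewrite !memE => s0 t0.
have l01 : 0 <= l%:num <= (1 : R) by apply/andP; split.
have := ch _ _ _ l01 s0 t0.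
by rewrite -lerN2 opprD -!mulrN.
Qed.

Lemma least_concave_majorantP (R : realType) (g : R -> \bar R) (h0 : R -> R) :
  (forall t, 0 <= t -> (0 <= g t)%E) -> concave_majorant g h0 ->
  concave_majorant g (least_concave_majorant g) /\
  forall h, concave_majorant g h ->
    forall t, 0 <= t -> least_concave_majorant g t <= h t.
Proof.
move=> g0 h0P.
have lb t : 0 <= t -> has_inf
    [set h t | h in [set h : R -> R | concave_majorant g h]].
  move=> t0; split; first by exists (h0 t), h0.
  exists 0 => _ [h [_ hP] <-]; rewrite -lee_fin.
  exact: le_trans (g0 _ t0) (hP _ t0).
have least h : concave_majorant g h ->
    forall t, 0 <= t -> least_concave_majorant g t <= h t.
  by move=> hP t t0; apply: ge_inf; [case: (lb _ t0)|exists h].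
split=> //; split.
- apply/concave_on_nonnegP => l s t l01 s0 t0.
  apply: lb_le_inf; first by exists (h0 (l * s + (1 - l) * t)), h0.
  move=> _ [h hP <-].
  have /concave_on_nonnegP/(_ _ _ _ l01 s0 t0) := hP.1.
  apply: le_trans; case/andP: l01 => l0 l1.
  by apply: lerD; apply: ler_wpM2l; rewrite ?subr_ge0//; apply: least.
- move=> t t0.
  have gt : g t \is a fin_num.
    rewrite ge0_fin_numE ?g0//.
    exact: le_lt_trans (h0P.2 _ t0) (ltry _).
  rewrite -(fineK gt) lee_fin; apply: lb_le_inf; first by exists (h0 t), h0.
  by move=> _ [h [_ hP] <-]; rewrite -lee_fin fineK// hP.
Qed.

(* Main.v *)
(* Concavity gives a supporting line [h t0 + c (t - t0) = B + c t] of the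
   majorant h at t0 = Dstar / (2 w), with B, c >= 0 because h >= 0. Hence
   |f'(t) - f'(x)| <= B + c |t - x|, and the first-order Taylor remainder at x
   is at most B |u - x| + c (u - x)^2 / 2. If D bounds the distance from x to
   the k-th integration interval, of length L >= Dstar / w, then the integral of
   |u - x| over it is at most D^2, so the mean of the remainder is at most
   B D^2 / L + c D^2 / 2 <= D^2 (w / Dstar) h(t0). With
   D = (|k - w x| + Mstar) / w, summing D^2 against |phi(w x - k)| produces A.
   The zeroth- and first-order terms are summed exactly by (i) and (iii). *)

Require Import Defs.
From HB Require Import structures.
From mathcomp Require Import all_boot all_order all_algebra.
From mathcomp Require Import all_classical all_reals all_analysis.
From mathcomp Require Import ring lra.

Import Order.TTheory GRing.Theory Num.Theory.
Import numFieldNormedType.Exports.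

Local Open Scope classical_set_scope.
Local Open Scope ring_scope.

(** * Supporting lines of nonnegative concave functions *)

(** The slope [c] is the supremum of the chord slopes to the right of [t0]; concavity bounds these
    by every chord slope to the left. Nonnegativity of [h] far to the right forces [0 <= c], and at
    0 it forces [c * t0 <= h t0]. *)
Lemma concave_supporting_line (R : realType) (h : R -> R) (t0 : R) :
  concave_on_nonneg h -> (forall t, 0 <= t -> 0 <= h t) -> 0 < t0 ->
  exists c, [/\ 0 <= c, c * t0 <= h t0 &
    forall t, 0 <= t -> h t <= h t0 + c * (t - t0)].
Proof.
move=> /concave_on_nonnegP ch h0 t0_gt0.
pose S := [set (h t - h t0) / (t - t0) | t in [set t | t0 < t]].
have slopes s t : 0 <= s -> s < t0 -> t0 < t ->
    (h t - h t0) / (t - t0) <= (h t0 - h s) / (t0 - s).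
  move=> s0 st0 t0t.
  have ts : 0 < t - s by lra.
  (* This is the weight of [s] when [t0] is written as a convex combination of [s] and [t]. *)
  have l01 : 0 <= (t - t0) / (t - s) <= 1.
    by rewrite divr_ge0 ?ler_pdivrMr//=; lra.
  have {ch} := ch _ s t l01 s0 (ltW (lt_trans (le_lt_trans s0 st0) t0t)).
  rewrite [in X in _ -> X]ler_pdivrMr ?subr_gt0//.
  rewrite [in X in _ -> X]mulrAC [in X in _ -> X]ler_pdivlMr ?subr_gt0//.
  have -> : (t - t0) / (t - s) * s + (1 - (t - t0) / (t - s)) * t = t0.
    by field; lra.
  have -> : (t - t0) / (t - s) * h s + (1 - (t - t0) / (t - s)) * h t =
            ((t - t0) * h s + (t0 - s) * h t) / (t - s).
    by field; lra.
  rewrite ler_pdivrMr//; lra.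
have S0 : S !=set0.
  by exists ((h (t0 + 1) - h t0) / (t0 + 1 - t0)); exists (t0 + 1) => //=; lra.
have Sub s : 0 <= s -> s < t0 -> ubound S ((h t0 - h s) / (t0 - s)).
  by move=> s0 st0 _ [t /= t0t <-]; exact: slopes.
have supS : has_sup S.
  by split=> //; exists ((h t0 - h 0) / (t0 - 0)); exact: Sub.
have right t : t0 < t -> h t <= h t0 + sup S * (t - t0).
  move=> t0t; have : (h t - h t0) / (t - t0) <= sup S.
    by apply: ub_le_sup; [case: supS|exists t].
  by rewrite ler_pdivrMr ?subr_gt0// => ?; lra.
have left s : 0 <= s -> s < t0 -> h s <= h t0 + sup S * (s - t0).
  move=> s0 st0; have : sup S <= (h t0 - h s) / (t0 - s).
    by apply: ge_sup => //; exact: Sub.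
  by rewrite ler_pdivlMr ?subr_gt0// => ?; lra.
exists (sup S); split.
- rewrite leNgt; apply/negP => c0.
  (* At this point a line of negative slope [sup S] through [(t0, h t0)] has value -1, contradicting
     [0 <= h t]. *)
  pose t := t0 + (h t0 + 1) / - sup S.
  have ht0 := h0 _ (ltW t0_gt0).
  have t0t : t0 < t by rewrite ltrDl divr_gt0//; lra.
  have := right _ t0t; have := h0 _ (ltW (lt_trans t0_gt0 t0t)).
  have -> : sup S * (t - t0) = - (h t0 + 1) by rewrite /t; field; lra.
  lra.
- have := left _ (lexx 0) t0_gt0; have := h0 _ (lexx 0); lra.
- move=> t t_ge0; have [/right//|/left->//|->] := ltgtP t0 t; lra.
Qed.

(** * Derivatives, increments and integrals over segments *)

Lemma is_derive_normr_sqr (R : realType) (v : R) :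
  is_derive v 1 (fun y : R => y * `|y| / 2) `|v|.
Proof.
have [v0|v0|->] := ltgtP v 0.
- apply: (@near_eq_is_derive _ _ _ (fun y : R => - (y ^+ 2 / 2))) => //.
    near=> y; have y0 : y < 0 by near: y; exact: lt_nbhsl.
    by rewrite ltr0_norm//; field.
  rewrite ltr0_norm//; apply: is_derive_eq.
  by rewrite /GRing.scale/=; field.
- apply: (@near_eq_is_derive _ _ _ (fun y : R => y ^+ 2 / 2)) => //.
    near=> y; have y0 : 0 < y by near: y; exact: lt_nbhsr.
    by rewrite gtr0_norm//; field.
  rewrite gtr0_norm//; apply: is_derive_eq.
  by rewrite /GRing.scale/=; field.
(* At 0 the difference quotient equals [|h| / 2], which tends to 0; it is written here in the
   unfolded form of the derivative. *)
have cv : h^-1 *: (((h *: 1 + 0) * `|h *: 1 + 0 : R| / 2) - (0 * `|0 : R| / 2))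
    @[h --> (0:R)^'] --> `|0 : R|.
  rewrite normr0; apply: cvg_trans (_ : `|h| / 2 @[h --> (0:R)^'] --> (0:R)).
    apply: near_eq_cvg; near=> h.
    have h0 : h != 0 by near: h; exact: nbhs_dnbhs_neq.
    rewrite /GRing.scale/= mulr1 addr0 mul0r mul0r subr0; field; exact: h0.
  apply: cvg_within_filter.
  have := cvgMr_tmp (b := 2^-1) (@norm_continuous R R 0).
  rewrite normr0 mul0r; apply; exact: nbhs_filter.
split; first by apply/cvg_ex; exists `|0 : R|.
exact: cvg_lim cv.
Unshelve. all: by end_near. Qed.

(** Since [|dF| <= dG], both [G - F] and [G + F] have nonnegative derivatives, hence are
    nondecreasing by the mean value theorem. *)
Lemma derivable_le_increment (R : realType) (F G dF dG : R -> R) (p q : R) :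
  (forall u : R, is_derive u 1 F (dF u)) ->
  (forall u : R, is_derive u 1 G (dG u)) ->
  (forall u, `|dF u| <= dG u) -> p <= q -> `|F q - F p| <= G q - G p.
Proof.
have step (E dE : R -> R) : (forall u : R, is_derive u 1 E (dE u)) ->
    (forall u, 0 <= dE u) -> p <= q -> E p <= E q.
  move=> Ed dE0 pq; rewrite -subr_ge0.
  have [|c _ ->] := @MVT_segment _ E dE p q pq (fun u _ => Ed u).
    by apply: derivable_within_continuous => u _; case: (Ed u).
  by rewrite mulr_ge0 ?subr_ge0.
move=> Fd Gd FG pq.
have := step (fun u => G u - F u) (fun u => dG u - dF u).
have := step (fun u => G u + F u) (fun u => dG u + dF u).
move=> /(_ _ _ pq) H1 /(_ _ _ pq) H2.
rewrite ler_norml; apply/andP; split.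
  suff : G p + F p <= G q + F q by lra.
  by apply: H1 => u; have := FG u; rewrite ler_norml; lra.
suff : G p - F p <= G q - F q by lra.
by apply: H2 => u; have := FG u; rewrite ler_norml; lra.
Qed.

Lemma continuous_integrable_itv (R : realType) (f : R -> R) (p q : R) :
  continuous f ->
  (@lebesgue_measure R).-integrable `[p, q] (EFin \o f).
Proof.
move=> cf; apply: continuous_compact_integrable; first exact: segment_compact.
exact: continuous_subspaceT.
Qed.

Lemma Rintegral_is_derive (R : realType) (f F : R -> R) (p q : R) :
  continuous f -> (forall u : R, is_derive u 1 F (f u)) -> p < q ->
  \int[lebesgue_measure]_(u in `[p, q]) f u = F q - F p.
Proof.
move=> cf Fd pq.
have cF : continuous F.
  by move=> u; apply/differentiable_continuous/derivable1_diffP; case: (Fd u).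
rewrite /Rintegral (@continuous_FTC2 _ f F)//.
- exact: continuous_subspaceT.
- split; first by move=> u _; case: (Fd u).
    exact/cvg_at_right_filter/cF.
  exact/cvg_at_left_filter/cF.
- by move=> u _; rewrite derive1E; case: (Fd u).
Qed.

(** * Sums over the integers *)

Lemma bilateral_psumE (R : realType) (c : int -> R) (pq : nat * nat) :
  bilateral_psum c pq =
  \sum_(k <- map Posz (iota 0 pq.1) ++ map Negz (iota 0 pq.2)) c k.
Proof. by rewrite big_cat !big_map /bilateral_psum /index_iota !subn0. Qed.

Lemma bilateral_psum_le_esum (R : realType) (c : int -> R) (pq : nat * nat) :
  (forall k, 0 <= c k) ->
  ((bilateral_psum c pq)%:E <= \esum_(k in [set: int]) (c k)%:E)%E.
Proof.
move=> c0; rewrite bilateral_psumE; set s := _ ++ _.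
have us : uniq s.
  rewrite cat_uniq !map_inj_uniq ?iota_uniq//; last 2 first.
  - by move=> ? ? [].
  - by move=> ? ? [].
  by rewrite andbT; apply/hasPn => _ /mapP[n _ ->]; apply/mapP => -[].
apply: esum_ge; exists [set` s].
  by split=> //; exact: finite_seq.
by rewrite -fsbig_seq// sumEFin.
Qed.

Lemma has_zsumD (R : realType) (c d : int -> R) (s t : R) :
  has_zsum c s -> has_zsum d t -> has_zsum (fun k => c k + d k) (s + t).
Proof.
move=> cs dt; rewrite /has_zsum.
rewrite (_ : bilateral_psum _ =
  fun pq => bilateral_psum c pq + bilateral_psum d pq).
  exact: cvgD.
by apply/funext => pq; rewrite !bilateral_psumE big_split.
Qed.

Lemma has_zsumZ (R : realType) (c : int -> R) (r s : R) :
  has_zsum c s -> has_zsum (fun k => r * c k) (r * s).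
Proof.
move=> cs; rewrite /has_zsum.
rewrite (_ : bilateral_psum _ = fun pq => r * bilateral_psum c pq).
  exact: cvgMl_tmp.
by apply/funext => pq; rewrite !bilateral_psumE big_distrr.
Qed.

Lemma has_zsum_unique (R : realType) (c : int -> R) (s : R) :
  has_zsum c s -> zsum c = s.
Proof. by move=> cs; apply: cvg_lim. Qed.

(** Domination makes the series over each half-line absolutely convergent, so the two ends may tend
    to infinity independently. The bound [B] holds for all partial sums and passes to the limit. *)
Lemma dominated_has_zsum (R : realType) (c e : int -> R) (B : R) :
  (forall k, `|c k| <= e k) -> (forall pq, bilateral_psum e pq <= B) ->
  exists2 s, has_zsum c s & `|s| <= B.
Proof.
move=> ce eB.
have e0 k : 0 <= e k by apply: le_trans (ce k).
have side (g : nat -> int) : (forall n, \sum_(0 <= i < n) e (g i) <= B) ->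
    cvgn (series (c \o g)).
  move=> gB; apply: normed_cvg.
  apply: nondecreasing_is_cvgn.
    by apply: nondecreasing_series => n _ _; exact: normr_ge0.
  exists B => _ [n _ <-]; apply: le_trans (gB n).
  by apply: ler_sum => i _; exact: ce.
have /cvg_ex[s1 s1P] : cvgn (series (c \o Posz)).
  apply: side => n; apply: le_trans (eB (n, 0%N)).
  by rewrite /bilateral_psum/= [X in _ + X]big_geq// addr0.
have /cvg_ex[s2 s2P] : cvgn (series (c \o Negz)).
  apply: side => n; apply: le_trans (eB (0%N, n)).
  by rewrite /bilateral_psum/= [X in X + _]big_geq// add0r.
have cs : has_zsum c (s1 + s2).
  apply: cvgD.
    by apply: (cvg_comp fst (series (c \o Posz))) s1P; exact: cvg_fst.
  by apply: (cvg_comp snd (series (c \o Negz))) s2P; exact: cvg_snd.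
exists (s1 + s2) => //.
have nc : `|bilateral_psum c pq| @[pq --> (\oo, \oo)] --> `|s1 + s2|.
  exact: cvg_norm.
rewrite -(cvg_lim _ nc)//; apply: limr_le;
  first by apply/cvg_ex; exists `|s1 + s2|.
apply: nearW => pq; apply: le_trans (eB pq).
rewrite !bilateral_psumE; apply: le_trans (ler_norm_sum _ _ _) _.
exact: ler_sum.
Qed.

(** * First-order Taylor remainder, pointwise and integrated *)

Lemma is_derive_normr_sqr_shift (R : realType) (x t : R) :
  is_derive t 1 (fun u : R => (u - x) * `|u - x| / 2) `|t - x|.
Proof.
have Pd := is_derive_normr_sqr _ (t - x).
have Sd : is_derive t 1 (fun u : R => u - x) 1.
  by apply: is_derive_eq; rewrite subr0.
have := @is_derive1_comp _ (fun y : R => y * `|y| / 2) (fun u => u - x)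
  t _ _ Pd Sd.
by rewrite mulr1.
Qed.

(** The remainder is the increment from [x] to [u] of a function with derivative [df t - df x]. It
    is compared with the increment of an antiderivative of [B + c * |t - x|], separately on each
    side of [x]. *)
Lemma taylor1_remainder_le (R : realType) (f df : R -> R) (x B c u : R) :
  (forall t : R, is_derive t 1 f (df t)) ->
  (forall t, `|df t - df x| <= B + c * `|t - x|) ->
  `|f u - f x - df x * (u - x)| <= B * `|u - x| + c * (u - x) ^+ 2 / 2.
Proof.
move=> fd dfB.
pose F t := f t - df x * (t - x).
pose G t := B * (t - x) + c * ((t - x) * `|t - x| / 2).
have Fd (t : R) : is_derive t 1 F (df t - df x).
  by apply: is_derive_eq; rewrite /GRing.scale/=; ring.
have Gd (t : R) : is_derive t 1 G (B + c * `|t - x|).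
  have PPd := is_derive_normr_sqr_shift _ x t.
  by apply: is_derive_eq; rewrite /GRing.scale/=; ring.
have -> : f u - f x - df x * (u - x) = F u - F x by rewrite /F; ring.
have [xu|ux] := leP x u.
  apply: le_trans (derivable_le_increment _ _ _ _ _ _ _ Fd Gd dfB xu) _.
  by rewrite /G ger0_norm ?subr_ge0//; lra.
rewrite distrC.
apply: le_trans (derivable_le_increment _ _ _ _ _ _ _ Fd Gd dfB (ltW ux)) _.
by rewrite /G subrr (@ltr0_norm _ (u - x)) ?subr_lt0//; lra.
Qed.

Lemma Rintegral_taylor1_remainder_le (R : realType) (f df : R -> R)
    (x B c D p q : R) :
  (forall t : R, is_derive t 1 f (df t)) ->
  (forall t, `|df t - df x| <= B + c * `|t - x|) ->
  0 <= B -> 0 <= c -> p < q -> `|p - x| <= D -> `|q - x| <= D ->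
  `|\int[lebesgue_measure]_(u in `[p, q]) f u
    - (q - p) * (f x + df x * ((p + q) / 2 - x))|
  <= B * D ^+ 2 + c * D ^+ 2 / 2 * (q - p).
Proof.
move=> fd dfB B0 c0 pq pD qD.
have cf : continuous f.
  by move=> u; apply/differentiable_continuous/derivable1_diffP; case: (fd u).
pose l u := f x + df x * (u - x).
pose L u := f x * u + df x * ((u - x) ^+ 2 / 2).
have Ld (u : R) : is_derive u 1 L (l u).
  by apply: is_derive_eq; rewrite /GRing.scale/= /l; field.
have cl : continuous l.
  move=> u; apply: cvgD; first exact: cvg_cst.
  by apply: cvgM; [exact: cvg_cst|apply: cvgB; [exact: cvg_id|exact: cvg_cst]].
(* Only the quadratic term is replaced by its maximum. The term [B * |u - x|] is integrated exactly,
   which yields [B * D ^+ 2] with no factor [q - p]; this is what survives division by the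
   length. *)
pose g u := B * `|u - x| + c * D ^+ 2 / 2.
pose G u := B * ((u - x) * `|u - x| / 2) + c * D ^+ 2 / 2 * u.
have cg : continuous g.
  move=> u; apply: cvgD; last exact: cvg_cst.
  apply: cvgM; first exact: cvg_cst.
  by apply: cvg_norm; apply: cvgB; [exact: cvg_id|exact: cvg_cst].
have Gd (u : R) : is_derive u 1 G (g u).
  have PPd := is_derive_normr_sqr_shift _ x u.
  by apply: is_derive_eq; rewrite /GRing.scale/= /g; ring.
have cfl : continuous (fun u => f u - l u).
  by move=> u; apply: cvgB; [exact: cf|exact: cl].
(* The mean of an affine function over a segment is its value at the midpoint. *)
have -> : (q - p) * (f x + df x * ((p + q) / 2 - x)) =
    \int[lebesgue_measure]_(u in `[p, q]) l u.
  by rewrite (Rintegral_is_derive _ _ _ _ _ cl Ld pq) /L; field.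
rewrite -RintegralB//; [|exact: continuous_integrable_itv..].
apply: le_trans (le_normr_Rintegral _ _) _ => //.
  exact: continuous_integrable_itv.
apply: (@le_trans _ _ (\int[lebesgue_measure]_(u in `[p, q]) g u)).
  apply: le_Rintegral => //.
  - by apply: continuous_integrable_itv => u; apply: cvg_norm; exact: cfl.
  - exact: continuous_integrable_itv.
  - move=> u; rewrite /= in_itv/= => /andP[pu uq].
    have uD : `|u - x| <= D by move: pD qD; rewrite !ler_norml; lra.
    have D0 : 0 <= D := le_trans (normr_ge0 _) uD.
    rewrite /l opprD addrA.
    apply: le_trans (taylor1_remainder_le _ _ _ _ _ _ _ fd dfB) _.
    rewrite lerD2l ler_wpM2r// ler_wpM2l//.
    by rewrite -real_normK ?num_real// lerXn2r ?nnegrE.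
rewrite (Rintegral_is_derive _ _ _ _ _ cg Gd pq) /G.
(* The antiderivative of [|u - x|] stays within [D ^+ 2 / 2] of 0 at both endpoints, so its
   increment is at most [D ^+ 2], wherever [x] lies. *)
have half (v : R) : `|v| <= D -> `|v * `|v| / 2| <= D ^+ 2 / 2.
  move=> vD; rewrite normrM normrM normr_id [`|2^-1|]ger0_norm// ler_wpM2r//.
  by rewrite -expr2 lerXn2r ?nnegrE// (le_trans (normr_ge0 _) vD).
have := half _ pD; have := half _ qD; rewrite !ler_norml.
move: ((p - x) * _ / 2) ((q - x) * _ / 2) => P Q /andP[_ HQ] /andP[HP _].
have : B * (Q - P) <= B * D ^+ 2 by apply: ler_wpM2l => //; lra.
lra.
Qed.

(** * Moments of the kernel and majorants of the modulus of continuity *)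

Lemma bilateral_psum_le_moment (R : realType) (phi : R -> R) (nu u : R) pq :
  ((bilateral_psum (fun k => `|phi (u - k%:~R)| * `|k%:~R - u| `^ nu) pq)%:E
   <= absolute_moment phi nu)%E.
Proof.
apply: le_trans (bilateral_psum_le_esum _ _ _ _) _.
  by move=> k; rewrite mulr_ge0 ?powR_ge0.
by apply: ereal_sup_ubound; exists u.
Qed.

Lemma bilateral_psum_quadratic_le (R : realType) (phi : R -> R) (M u : R) pq :
  0 <= M ->
  ((bilateral_psum
      (fun k => `|phi (u - k%:~R)| * (`|k%:~R - u| + M) ^+ 2) pq)%:E
   <= (M ^+ 2)%:E * absolute_moment phi 0
      + (2 * M)%:E * absolute_moment phi 1 + absolute_moment phi 2)%E.
Proof.
move=> M0.
pose m nu k := `|phi (u - k%:~R)| * `|k%:~R - u| `^ nu.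
have -> : bilateral_psum
      (fun k => `|phi (u - k%:~R)| * (`|k%:~R - u| + M) ^+ 2) pq =
    M ^+ 2 * bilateral_psum (m 0) pq + (2 * M) * bilateral_psum (m 1) pq
      + bilateral_psum (m 2) pq.
  rewrite !bilateral_psumE !big_distrr -!big_split/=; apply: eq_bigr => k _.
  (* A zeroth power is 1 even at base 0, so a term with [k = u] is counted in the moment of order
     0. *)
  by rewrite /m powRr0 powRr1// powR_mulrn//; ring.
rewrite !EFinD !EFinM.
by apply: leeD; first (apply: leeD; apply: lee_wpmul2l;
  rewrite ?lee_fin ?mulr_ge0 ?exprn_ge0//); exact: bilateral_psum_le_moment.
Qed.

(** If [|g| <= C], the constant [2 * C] is a concave majorant of the modulus, so the infimum
    defining the least one is over a nonempty family. *)
Lemma modulus_of_continuity_concave_majorant (R : realType) (g : R -> R) :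
  bounded_fun g ->
  concave_majorant (modulus_of_continuity g)
    (least_concave_majorant (modulus_of_continuity g)).
Proof.
move=> bg.
have [C gC] := (@ex_bound _ _ _ _ _
  (@globally_properfilter _ setT (0 : R) I)).1 bg.
have [] // := @least_concave_majorantP R (modulus_of_continuity g)
  (fun=> 2 * C).
  move=> t t0; apply: ereal_sup_ubound.
  by exists (0, 0) => /=; rewrite subrr normr0.
split.
  by apply/concave_on_nonnegP => l s t _ _ _; lra.
move=> t t0; apply: ge_ereal_sup => _ [[y z] _ <-]; rewrite lee_fin/=.
have /= := gC y I; have /= := gC z I; have := ler_normB (g y) (g z); lra.
Qed.

(** * Summation of the local errors against the kernel *)

Theorem theorem2p2 (R : realType) (phi : R -> R)
    (phi_CR : CR phi)
    (phi_sum : forall u : R, has_zsum (fun k : int => phi (u - k%:~R)) 1)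
    (phi_M2 : (absolute_moment phi 2 < +oo)%E)
    (phi_tail : forall e : R, 0 < e -> \forall r \near +oo, forall u : R,
      (\esum_(k in [set k : int | (r < `|u - k%:~R|)%R]%classic)
         (`|phi (u - k%:~R)| * (k%:~R - u) ^+ 2)%:E < e%:E)%E)
    (phi_mom1 : forall u : R,
      has_zsum (fun k : int => phi (u - k%:~R) * (k%:~R - u)) 0)
    (a b : int -> R) (alpha Dstar Mstar : R)
    (Dstar_gt0 : 0 < Dstar)
    (ab_sum : forall k, a k + b k = alpha)
    (ab_gap : forall k, Dstar <= b k - a k)
    (ab_bound : forall k, `|a k| <= Mstar /\ `|b k| <= Mstar)
    (f : R -> R) (f_C1 : C1 f) :
  forall x w : R, 0 < w ->
    let A : \bar R :=
      ((Mstar ^+ 2)%:E * absolute_moment phi 0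
       + (2 * Mstar)%:E * absolute_moment phi 1
       + absolute_moment phi 2)%E in
    ((`|w * (kantorovich phi a b w f x - f x) - alpha * derive1 f x / 2|)%:E
     <= A * (Dstar^-1)%:E
        * (least_concave_majorant (modulus_of_continuity (derive1 f))
             (Dstar / (2 * w)))%:E)%E.
Proof.
move=> x w w0; cbv zeta; set A := (_ + absolute_moment phi 2)%E.
have [_ f_deriv _ df_bounded] := f_C1.
have M0 : 0 <= Mstar by apply: le_trans (ab_bound 0).1.
have [h_concave] := modulus_of_continuity_concave_majorant _ _ df_bounded.
set h := least_concave_majorant _ in h_concave *; move=> h_major.
have modulus_ge (s t : R) : ((`|derive1 f s - derive1 f t|)%:E
    <= modulus_of_continuity (derive1 f) `|s - t|%R)%E.
  by apply: ereal_sup_ubound; exists (s, t) => /=.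
have df_h (s t : R) : `|derive1 f s - derive1 f t| <= h `|s - t|.
  by rewrite -lee_fin (le_trans (modulus_ge _ _))// h_major.
have h_ge0 t : 0 <= t -> 0 <= h t.
  move=> t_ge0; have := df_h t 0; rewrite subr0 (ger0_norm t_ge0).
  exact/le_trans/normr_ge0.
pose t0 := Dstar / (2 * w).
have t0_gt0 : 0 < t0 by rewrite divr_gt0// mulr_gt0.
have [c [c0 ct0 h_line]] :=
  concave_supporting_line _ _ _ h_concave h_ge0 t0_gt0.
(* [B] is the value at 0 of the supporting line. *)
pose B := h t0 - c * t0.
have B0 : 0 <= B by rewrite subr_ge0.
have df_line t : `|derive1 f t - derive1 f x| <= B + c * `|t - x|.
  apply: le_trans (df_h _ _) _.
  by have := h_line _ (normr_ge0 (t - x)); rewrite /B; lra.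
have fd (t : R) : is_derive t 1 f (derive1 f t).
  by rewrite derive1E; exact/derivableP.
pose u := w * x.
pose p k := (k%:~R + a k) / w; pose q k := (k%:~R + b k) / w.
pose I k := \int[lebesgue_measure]_(v in `[p k, q k]) f v.
pose E k := I k - (q k - p k) * (f x + derive1 f x * ((p k + q k) / 2 - x)).
pose d k := `|k%:~R - u| + Mstar.
have gap_gt0 k : 0 < b k - a k := lt_le_trans Dstar_gt0 (ab_gap k).
have E_le k : `|E k| <= B * (d k / w) ^+ 2
    + c * (d k / w) ^+ 2 / 2 * ((b k - a k) / w).
  have dist y : `|y| <= Mstar -> `|(k%:~R + y) / w - x| <= d k / w.
    move=> yM; have -> : (k%:~R + y) / w - x = ((k%:~R - u) + y) / w.
      by rewrite /u; field; rewrite gt_eqF.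
    rewrite normrM [`|w^-1|]gtr0_norm ?invr_gt0// ler_pM2r ?invr_gt0//.
    by apply: le_trans (ler_normD _ _) _; rewrite lerD2l.
  have pq : p k < q k.
    by rewrite /p /q ltr_pM2r ?invr_gt0// ltrD2l -subr_gt0.
  have -> : (b k - a k) / w = q k - p k by rewrite /p /q; field; rewrite gt_eqF.
  apply: Rintegral_taylor1_remainder_le => //.
    exact/dist/(ab_bound k).1.
  exact/dist/(ab_bound k).2.
(* [r k] is [w] times the share of the Taylor remainder in the [k]-th term of the series, and [e k]
   is its dominating term. *)
pose r k := w * (w / (b k - a k) * phi (u - k%:~R) * E k).
pose e k := h t0 / Dstar * (`|phi (u - k%:~R)| * d k ^+ 2).
have r_le k : `|r k| <= e k.
  rewrite /r /e !normrM normfV.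
  rewrite (gtr0_norm w0) (gtr0_norm (gap_gt0 k)).
  have -> : w * (w / (b k - a k) * `|phi (u - k%:~R)| * `|E k|) =
    `|phi (u - k%:~R)| * (w ^+ 2 / (b k - a k) * `|E k|) by ring.
  rewrite [leRHS]mulrCA ler_wpM2l//.
  apply: le_trans (ler_wpM2l _ (E_le k)) _.
    by rewrite divr_ge0 ?sqr_ge0// ltW.
  have -> : w ^+ 2 / (b k - a k) * (B * (d k / w) ^+ 2
      + c * (d k / w) ^+ 2 / 2 * ((b k - a k) / w)) =
      (B / (b k - a k) + c / (2 * w)) * d k ^+ 2.
    by field; rewrite !gt_eqF.
  rewrite ler_wpM2r ?sqr_ge0//.
  (* The choice [t0 = Dstar / (2 * w)] makes the two error coefficients, with [Dstar] in place of
     [b k - a k], add up exactly to [h t0 / Dstar]. *)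
  have -> : h t0 / Dstar = B / Dstar + c / (2 * w).
    by rewrite /B /t0; field; rewrite !gt_eqF.
  by rewrite lerD2r ler_wpM2l// lef_pV2 ?posrE.
have e_psum pq : ((bilateral_psum e pq)%:E <= A * (Dstar^-1)%:E * (h t0)%:E)%E.
  have -> : bilateral_psum e pq = bilateral_psum
      (fun k => `|phi (u - k%:~R)| * d k ^+ 2) pq * (Dstar^-1 * h t0).
    by rewrite !bilateral_psumE /e -big_distrr/=; ring.
  rewrite EFinM -muleA -(EFinM Dstar^-1) lee_wpmul2r//.
    by rewrite lee_fin mulr_ge0 ?invr_ge0 ?h_ge0// ltW.
  exact: bilateral_psum_quadratic_le.
(* An infinite right-hand side makes the bound trivial. Otherwise it is a real number [T], the value
   -oo being excluded by the empty partial sum. *)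
have [->|AB] := eqVneq (A * (Dstar^-1)%:E * (h t0)%:E)%E +oo%E.
  exact: leey.
have ABfin : (A * (Dstar^-1)%:E * (h t0)%:E)%E \is a fin_num.
  rewrite fin_real// [X in _ && X]lt_neqAle AB leey !andbT.
  exact: lt_le_trans (ltNyr _) (e_psum (0, 0)%N).
move: e_psum; rewrite -(fineK ABfin); set T := fine _ => e_psum.
have [|s s_sum s_le] := dominated_has_zsum _ r e T r_le.
  by move=> pq; rewrite -lee_fin.
rewrite lee_fin; apply: le_trans s_le.
(* The midpoint of the [k]-th interval differs from [x] by [(k - u) / w + alpha / (2 * w)]. The
   summands are thus the value [f x], the vanishing first moment, the shift by [alpha / (2 * w)],
   and the remainder, where [w^-1] undoes the factor [w] in [r]. *)
suff -> : kantorovich phi a b w f x =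
    f x * 1 + derive1 f x / w * 0 + derive1 f x * alpha / (2 * w) * 1
    + w^-1 * s.
  by rewrite le_eqVlt; apply/orP; left; apply/eqP; congr `|_|; field;
     rewrite gt_eqF.
apply: has_zsum_unique.
have := has_zsumD _ _ _ _ _ (has_zsumD _ _ _ _ _ (has_zsumD _ _ _ _ _
  (has_zsumZ _ _ (f x) _ (phi_sum u))
  (has_zsumZ _ _ (derive1 f x / w) _ (phi_mom1 u)))
  (has_zsumZ _ _ (derive1 f x * alpha / (2 * w)) _ (phi_sum u)))
  (has_zsumZ _ _ w^-1 _ s_sum).
congr (has_zsum _ _); apply/funext => k.
rewrite /r /E -/(I k) /p /q -(ab_sum k) /u; field.
by rewrite !gt_eqF.
Qed.
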